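(* Let $F$ be the function field of a smooth projective curve over $\mathbb{F}_q$, $x$ a place of $F$ with residue field $\kappa_x$ of cardinality $q_x$, and $[g]\in G(F)\backslash G(\mathbb{A})/K$. The $\Phi_x$-neighbours of $[g]$ are the classes $[g\xi_w]$ with $w\in\mathbb{P}^1(\kappa_x)$, and the multiplicity of an edge from $[g]$ to $[g']$ equals the number of $w\in\mathbb{P}^1(\kappa_x)$ such that $[g\xi_w]=[g']$. The multiplicities of the edges originating in $[g]$ sum up to $\#\mathbb{P}^1(\kappa_x)=q_x+1$.
   Context: $\mathbb{A}$ is the adele ring of $F$, $\mathcal{O}_{\mathbb{A}}=\prod_y\mathcal{O}_y$, $G=\mathrm{PGL}_2$, $K=G(\mathcal{O}_{\mathbb{A}})$, Haar measure on $G(\mathbb{A})$ with $\mathrm{vol}\,K=1$. $\pi_x$ is a uniformizer at $x$, viewed as an idele concentrated at $x$; elements $b\in\kappa_x\subset F_x$ are viewed as adeles with component $b$ at $x$ and $0$ elsewhere. Put $\xi_w=\begin{pmatrix}\pi_x&b\\0&1\end{pmatrix}$ if $w=[1:b]$ and $\xi_w=\begin{pmatrix}1&0\\0&\pi_x\end{pmatrix}$ if $w=[0:1]$. $\Phi_x$ is the characteristic function of $K\begin{pmatrix}\pi_x&0\\0&1\end{pmatrix}K$, acting by $\Phi_x(f)(g)=\int_{G(\mathbb{A})}\Phi_x(h)f(gh)\,dh$. For each $[g]$ there are unique pairwise distinct classes $[g_1],\dots,[g_r]$ and numbers $m_i\in\mathbb{C}^\times$ with $\Phi_x(f)(g)=\sum_im_if(g_i)$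 for all functions $f$ on $G(F)\backslash G(\mathbb{A})/K$. The $[g_i]$ are the $\Phi_x$-neighbours of $[g]$, the triples $([g],[g_i],m_i)$ are the edges originating in $[g]$, and $m_i$ is called their multiplicity (or weight). *)

(* Defs.v *)
From HB Require Import structures.
From mathcomp Require Import all_boot all_order all_algebra all_field.
From mathcomp Require Import fraction generic_quotient.
From mathcomp Require Import all_classical all_reals all_analysis.
From mathcomp Require Import complex.

Set Implicit Arguments.
Unset Strict Implicit.
Unset Printing Implicit Defensive.

Import Order.TTheory GRing.Theory Num.Theory.

Local Open Scope classical_set_scope.
Local Open Scope ring_scope.
Local Open Scope quotient_scope.

(* Normalized discrete valuations; [dval a = -oo] is excluded by the axioms. *)
Record discrete_valuation (K : fieldType) := DiscreteValuation {
  dval :> K -> \bar int ;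
  dval_infty : forall a, dval a = +oo%E <-> a = 0 ;
  dvalM : forall a b, dval (a * b) = (dval a + dval b)%E ;
  dvalD : forall a b, (Order.min (dval a) (dval b) <= dval (a + b)%R)%E ;
  dval_normalized : exists a, dval a = 1%:E }.

HB.instance Definition _ (K : fieldType) := gen_eqMixin (discrete_valuation K).
HB.instance Definition _ (K : fieldType) :=
  gen_choiceMixin (discrete_valuation K).

(* For a function field over a finite field, the places are exactly the
   normalized discrete valuations: the nonzero constants are roots of unity,
   so triviality on the constants is automatic. *)
Notation place F := (discrete_valuation F).

Section ValuationTheory.
Variables (K : fieldType) (v : discrete_valuation K).

Lemma dval0 : v 0 = +oo%E.
Proof. exact/dval_infty. Qed.

Lemma dval_neqNy a : v a <> -oo%E.
Proof.
move=> va; have := dvalM v a 0.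
by rewrite mulr0 dval0 va.
Qed.

Lemma dval_fin a : a != 0 -> exists n : int, v a = n%:E.
Proof.
move=> a0; case va : (v a) => [n| |]; first by exists n.
- by move/dval_infty : va a0 => ->; rewrite eqxx.
- by have := dval_neqNy va.
Qed.

Lemma dval1 : v 1 = 0%E.
Proof.
have [n vn] := dval_fin (oner_neq0 K).
have := dvalM v 1 1; rewrite mulr1 vn -EFinD => -[] /eqP.
by rewrite -subr_eq0 opprD addrA subrr sub0r oppr_eq0 => /eqP ->.
Qed.

Lemma dvalN a : v (- a) = v a.
Proof.
have [n vn] : exists n : int, v (- 1) = n%:E.
  by apply: dval_fin; rewrite oppr_eq0 oner_neq0.
have : v (-1) = 0%E.
  have := dvalM v (-1) (-1); rewrite mulrNN mulr1 dval1 vn -EFinD => -[] /eqP.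
  by rewrite eq_sym -mulr2n mulrn_eq0 /= => /eqP ->.
by move=> vN1; rewrite -[- a]mulN1r dvalM vN1 add0e.
Qed.

Lemma dval_geD (n : \bar int) a b :
  (n <= v a)%E -> (n <= v b)%E -> (n <= v (a + b)%R)%E.
Proof.
by move=> na nb; apply: (le_trans _ (dvalD v a b)); rewrite le_min na nb.
Qed.

Definition integral_pred : {pred K} := fun a => (0 <= v a)%E.

Lemma integral_subring : subring_closed integral_pred.
Proof.
split=> [|a b|a b]; rewrite !unfold_in /integral_pred.
- by rewrite dval1.
- by move=> va vb; apply: dval_geD => //; rewrite dvalN.
- by move=> va vb; rewrite dvalM adde_ge0.
Qed.

HB.instance Definition _ :=
  GRing.isSubringClosed.Build K integral_pred integral_subring.

Record integers := Integer { ival : K ; ivalP : ival \in integral_pred }.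

HB.instance Definition _ := [isSub for ival].
HB.instance Definition _ := [Choice of integers by <:].
HB.instance Definition _ := [SubChoice_isSubComNzRing of integers by <:].

Definition val_open (U : set K) :=
  forall a, U a -> exists n : int, forall b, (n%:E <= v (b - a)%R)%E -> U b.

Definition val_cauchy (u : nat -> K) :=
  forall n : int, exists N, forall i j,
    (N <= i)%N -> (N <= j)%N -> (n%:E <= v (u i - u j)%R)%E.

Definition val_converges (u : nat -> K) (l : K) :=
  forall n : int, exists N, forall i, (N <= i)%N -> (n%:E <= v (u i - l)%R)%E.

(* The residue field of [v], identified with a subfield of the ring of
   integers through a multiplicative and additive section of the residue map.
   When [K] is the completion of a global function field, such a section
   exists and is unique. *)
Record residue_field := ResidueField {
  rf_sort :> finFieldType ;
  rf_res : {rmorphism integers -> rf_sort} ;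
  rf_lift : {rmorphism rf_sort -> integers} ;
  rf_res_surj : forall b, exists a, rf_res a = b ;
  rf_res_ker : forall a, rf_res a = 0 <-> (0 < v (ival a))%E ;
  rf_liftK : cancel rf_lift rf_res }.

End ValuationTheory.

Record completion (F : fieldType) (y : place F) := Completion {
  cfield :> fieldType ;
  cval : discrete_valuation cfield ;
  cemb : {rmorphism F -> cfield} ;
  cval_emb : forall a, cval (cemb a) = y a ;
  cemb_dense : forall a (n : int), exists c, (n%:E <= cval (a - cemb c)%R)%E ;
  c_complete : forall u, val_cauchy cval u -> exists l, val_converges cval u l }.

Section Adeles.
Variables (F : fieldType) (Fc : forall y : place F, completion y).

Definition almost_integral (a : forall y, Fc y) :=
  finite_set [set y | a y \notin integral_pred (cval (Fc y))].

Record adele := Adele {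
  acomp :> forall y, Fc y ;
  acompP : almost_integral acomp }.

HB.instance Definition _ := gen_eqMixin adele.
HB.instance Definition _ := gen_choiceMixin adele.

Lemma adele_ext (a b : adele) : (forall y, a y = b y) -> a = b.
Proof.
case: a b => [a aP] [b bP] /= ab.
have {}ab : a = b by exact: functional_extensionality_dep.
by move: bP; rewrite -ab => bP; congr Adele; exact: Prop_irrelevance.
Qed.

Fact adele0_subproof : almost_integral (fun y => 0).
Proof.
apply: (sub_finite_set _ (finite_set0 (place F))) => y /=.
by rewrite rpred0.
Qed.

Fact adele1_subproof : almost_integral (fun y => 1).
Proof.
apply: (sub_finite_set _ (finite_set0 (place F))) => y /=.
by rewrite rpred1.
Qed.

Fact adeleN_subproof (a : adele) : almost_integral (fun y => - a y).
Proof. by apply: (sub_finite_set _ (acompP a)) => y /=; rewrite rpredN. Qed.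

Fact adeleD_subproof (a b : adele) : almost_integral (fun y => a y + b y).
Proof.
have : finite_set ([set y | a y \notin integral_pred (cval (Fc y))] `|`
                   [set y | b y \notin integral_pred (cval (Fc y))]).
  by rewrite finite_setU; split; exact: acompP.
apply: sub_finite_set => y /=; apply: contraNP => /not_orP[/negP].
by rewrite negbK => ay /negP; rewrite negbK => bY; exact: rpredD.
Qed.

Fact adeleM_subproof (a b : adele) : almost_integral (fun y => a y * b y).
Proof.
have : finite_set ([set y | a y \notin integral_pred (cval (Fc y))] `|`
                   [set y | b y \notin integral_pred (cval (Fc y))]).
  by rewrite finite_setU; split; exact: acompP.
apply: sub_finite_set => y /=; apply: contraNP => /not_orP[/negP].
by rewrite negbK => ay /negP; rewrite negbK => bY; exact: rpredM.
Qed.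

Definition adele0 := Adele adele0_subproof.
Definition adele1 := Adele adele1_subproof.
Definition adeleN a := Adele (adeleN_subproof a).
Definition adeleD a b := Adele (adeleD_subproof a b).
Definition adeleM a b := Adele (adeleM_subproof a b).

Fact adele_addA : associative adeleD.
Proof. by move=> a b c; apply: adele_ext => y /=; rewrite addrA. Qed.
Fact adele_addC : commutative adeleD.
Proof. by move=> a b; apply: adele_ext => y /=; rewrite addrC. Qed.
Fact adele_add0 : left_id adele0 adeleD.
Proof. by move=> a; apply: adele_ext => y /=; rewrite add0r. Qed.
Fact adele_addN : left_inverse adele0 adeleN adeleD.
Proof. by move=> a; apply: adele_ext => y /=; rewrite addNr. Qed.
Fact adele_mulA : associative adeleM.
Proof. by move=> a b c; apply: adele_ext => y /=; rewrite mulrA. Qed.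
Fact adele_mulC : commutative adeleM.
Proof. by move=> a b; apply: adele_ext => y /=; rewrite mulrC. Qed.
Fact adele_mul1 : left_id adele1 adeleM.
Proof. by move=> a; apply: adele_ext => y /=; rewrite mul1r. Qed.
Fact adele_mulDl : left_distributive adeleM adeleD.
Proof. by move=> a b c; apply: adele_ext => y /=; rewrite mulrDl. Qed.

HB.instance Definition _ := GRing.isZmodule.Build adele
  adele_addA adele_addC adele_add0 adele_addN.
HB.instance Definition _ := GRing.Zmodule_isComPzRing.Build adele
  adele_mulA adele_mulC adele_mul1 adele_mulDl.

(* The restricted product topology. *)
Definition adele_open (U : set adele) :=
  forall a, U a -> exists V : forall y, set (Fc y),
    [/\ forall y, val_open (cval (Fc y)) (V y),
        finite_set [set y | V y <> [set` integral_pred (cval (Fc y))]],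
        forall y, V y (a y)
      & forall b : adele, (forall y, V y (b y)) -> U b].

Lemma val_open_integers y :
  val_open (cval (Fc y)) [set` integral_pred (cval (Fc y))].
Proof.
move=> a /= ia; exists 0 => b ib.
by rewrite -[b](subrK a); apply: rpredD.
Qed.

Fact adele_openT : adele_open setT.
Proof.
move=> a _; exists (fun y => [set c | a y \in integral_pred (cval (Fc y)) ->
                                      c \in integral_pred (cval (Fc y))]).
split=> [y||y //|//].
  have [ia|nia] := boolP (a y \in integral_pred (cval (Fc y))).
    move=> b /(_ erefl) ib; have [n nb] := val_open_integers ib.
    by exists n => c /nb cb _; exact: cb.
  by move=> b _; exists 0.
apply: (sub_finite_set _ (acompP a)) => y /=.
apply: contra_notN => ia.
by apply/seteqP; split=> c /=; [exact|].
Qed.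

Fact adele_openI : setI_closed adele_open.
Proof.
move=> U1 U2 o1 o2 a [/o1[V1 [oV1 f1 a1 s1]] /o2[V2 [oV2 f2 a2 s2]]].
exists (fun y => V1 y `&` V2 y); split=> //.
- move=> y b [/oV1[n1 h1] /oV2[n2 h2]]; exists (Order.max n1 n2) => c hc.
  split; [apply: h1|apply: h2]; apply: le_trans hc;
    by rewrite lee_fin le_max lexx ?orbT.
- have : finite_set
    ([set y | V1 y <> [set` integral_pred (cval (Fc y))]] `|`
     [set y | V2 y <> [set` integral_pred (cval (Fc y))]]).
    by rewrite finite_setU.
  apply: sub_finite_set => y /= V12; apply/not_andP => -[e1 e2].
  by apply: V12; rewrite e1 e2 setIid.
- by move=> b hb; split; [apply: s1 => y|apply: s2 => y]; have [] := hb y.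
Qed.

Fact adele_open_bigU (I : Type) (f : I -> set adele) :
  (forall i, adele_open (f i)) -> adele_open (\bigcup_i f i).
Proof.
move=> of_ a [i _ /of_[V [oV fV aV sV]]]; exists V; split=> // b /sV fb.
by exists i.
Qed.

HB.instance Definition _ := isOpenTopological.Build adele
  adele_openT adele_openI adele_open_bigU.

Definition integral_adele (a : adele) :=
  forall y, a y \in integral_pred (cval (Fc y)).

Fact adele_with_subproof (a : adele) (x : place F) (c : Fc x) :
  almost_integral (@dfwith (place F) (fun y => Fc y) a x c).
Proof.
have : finite_set ([set x] `|`
                   [set y | a y \notin integral_pred (cval (Fc y))]).
  by rewrite finite_setU; split; [exact: finite_set1|exact: acompP].
apply: sub_finite_set => y /=.
by case: (@dfwithP _ (fun y => Fc y) a x c) => [_|z xz nz]; [left|right].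
Qed.

(* The adele [a] with its component at [x] replaced by [c]; the idele
   concentrated at [x] is the case [a = 1]. *)
Definition adele_with a x c := Adele (@adele_with_subproof a x c).

End Adeles.
Arguments adele_with {F Fc} a [x] c.

(* Carrying the inverse makes the entries of both matrices available for the
   topology of the group of units. *)
Record GL2 (A : comPzRingType) := MkGL2 {
  gl_mx : 'M[A]_2 ;
  gl_inv : 'M[A]_2 ;
  gl_mxV : gl_mx *m gl_inv = 1%:M ;
  gl_Vmx : gl_inv *m gl_mx = 1%:M }.

Section PGL2.
Variable A : comPzRingType.

HB.instance Definition _ := gen_eqMixin (GL2 A).
HB.instance Definition _ := gen_choiceMixin (GL2 A).

Definition gl_one : GL2 A := MkGL2 (mul1mx 1%:M) (mul1mx 1%:M).

Fact gl_mul_subproof (M N M' N' : 'M[A]_2) :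
  M *m M' = 1%:M -> N *m N' = 1%:M -> (M *m N) *m (N' *m M') = 1%:M.
Proof. by move=> MV NV; rewrite mulmxA -(mulmxA M) NV mulmx1. Qed.

Definition gl_mul (M N : GL2 A) : GL2 A :=
  MkGL2 (gl_mul_subproof (gl_mxV M) (gl_mxV N))
        (gl_mul_subproof (gl_Vmx N) (gl_Vmx M)).

Definition pgl_eqv (M N : GL2 A) : bool :=
  `[< exists c d : A, c * d = 1 /\ gl_mx N = c *: gl_mx M >].

Fact pgl_eqv_equiv : equiv_class_of pgl_eqv.
Proof.
split=> [M|M N|M N P].
- by apply/asboolP; exists 1, 1; rewrite mulr1 scale1r.
- apply/asboolP/asboolP => -[c [d [cd e]]]; exists d, c;
    by rewrite mulrC cd e scalerA mulrC cd scale1r.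
- move=> /asboolP[c [d [cd e]]] /asboolP[c' [d' [cd' e']]].
  apply/asboolP; exists (c' * c), (d' * d).
  by rewrite mulrACA cd cd' mulr1 e' e scalerA.
Qed.

Canonical pgl_eqv_rel := EquivRelPack pgl_eqv_equiv.

Definition PGL2 := {eq_quot pgl_eqv}.

HB.instance Definition _ := EqQuotient.on PGL2.
HB.instance Definition _ := Choice.on PGL2.
HB.instance Definition _ := isPointed.Build PGL2 (\pi_PGL2 gl_one).

Definition pgl_class (M : GL2 A) : PGL2 := \pi_PGL2 M.

Definition pgl_mul (g h : PGL2) : PGL2 := pgl_class (gl_mul (repr g) (repr h)).

Lemma pgl_mulE M N :
  pgl_mul (pgl_class M) (pgl_class N) = pgl_class (gl_mul M N).
Proof.
rewrite /pgl_mul /pgl_class; apply/eqmodP/asboolP.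
have /eqmodP/asboolP[c [d [cd cE]]] := reprK (\pi_PGL2 M).
have /eqmodP/asboolP[c' [d' [cd' cE']]] := reprK (\pi_PGL2 N).
exists (c * c'), (d * d'); split; first by rewrite mulrACA cd cd' mulr1.
by rewrite /= cE cE' -scalemxAl -scalemxAr scalerA.
Qed.

Definition mx2 (a b c d : A) : 'M[A]_2 := \matrix_(i, j)
  if i == 0 then (if j == 0 then a else b) else (if j == 0 then c else d).

Fact borel2_subproof (a a' b d d' : A) : a * a' = 1 -> d * d' = 1 ->
  mx2 a b 0 d *m mx2 a' (- (a' * b * d')) 0 d' = 1%:M.
Proof.
move=> aa' dd'; apply/matrixP => i j; rewrite !mxE big_ord_recl big_ord1 !mxE /=.
case: i j => [[|[|//]] ?] [[|[|//]] ?] //=;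
  rewrite ?(mulr0, mul0r, addr0, add0r) //.
by rewrite mulrN !mulrA aa' mul1r addNr.
Qed.

Fact borel2_subproofV (a a' b d d' : A) : a * a' = 1 -> d * d' = 1 ->
  mx2 a' (- (a' * b * d')) 0 d' *m mx2 a b 0 d = 1%:M.
Proof.
move=> aa' dd'; have a'a : a' * a = 1 by rewrite mulrC.
have d'd : d' * d = 1 by rewrite mulrC.
apply/matrixP => i j; rewrite !mxE big_ord_recl big_ord1 !mxE /=.
case: i j => [[|[|//]] ?] [[|[|//]] ?] //=;
  rewrite ?(mulr0, mul0r, addr0, add0r) //.
by rewrite mulNr -(mulrA _ d') d'd mulr1 addrN.
Qed.

(* The invertible matrix (a, b; 0, d), given inverses [a'], [d'] of [a], [d]. *)
Definition upper_gl2 (a a' b d d' : A) (aa' : a * a' = 1) (dd' : d * d' = 1) :=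
  MkGL2 (borel2_subproof b aa' dd') (borel2_subproofV b aa' dd').

End PGL2.

Section AdelicGroup.
Variables (F : fieldType) (Fc : forall y : place F, completion y).
Local Notation A := (adele Fc).

Definition gl_pair (M : GL2 A) : 'M[A]_2 * 'M[A]_2 := (gl_mx M, gl_inv M).

Definition adelic_gl2_open (U : set (GL2 A)) :=
  open (U : set (initial_topology gl_pair)).

(* GL_2(A) -> PGL_2(A) is surjective with kernel A^*: this holds for each field
   F_y and each local ring O_y. *)
Definition GA := PGL2 A.

Definition GA_open (U : set GA) := adelic_gl2_open (@pgl_class A @^-1` U).

Fact GA_openT : GA_open setT.
Proof. exact: openT. Qed.

Fact GA_openI : setI_closed GA_open.
Proof. by move=> U V oU oV; exact: openI. Qed.

Fact GA_open_bigU (I : Type) (f : I -> set GA) :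
  (forall i, GA_open (f i)) -> GA_open (\bigcup_i f i).
Proof. by move=> of_; apply: bigcup_open => i _; exact: of_. Qed.

HB.instance Definition _ := Pointed.on GA.
HB.instance Definition _ := isOpenTopological.Build GA
  GA_openT GA_openI GA_open_bigU.

(* G(F), diagonally embedded; as an element of [F] has only finitely many
   poles, every [gamma] in GL_2(F) does come from some [M] in GL_2(A). *)
Definition GF : set GA := [set g | exists (gamma : GL2 F) (M : GL2 A),
  (forall i j y, gl_mx M i j y = cemb (Fc y) (gl_mx gamma i j)) /\
  g = pgl_class M].

(* K = G(O_A) *)
Definition GO : set GA := [set g | exists M : GL2 A,
  (forall i j, integral_adele (gl_mx M i j)) /\
  (forall i j, integral_adele (gl_inv M i j)) /\ g = pgl_class M].

Definition double_coset (g : GA) : set GA :=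
  [set h | exists gamma u, [/\ GF gamma, GO u & h = pgl_mul (pgl_mul gamma g) u]].

Definition GF_GA_K := {C : set GA | exists g, C = double_coset g}.

HB.instance Definition _ := gen_eqMixin GF_GA_K.
HB.instance Definition _ := gen_choiceMixin GF_GA_K.

Definition dcls (g : GA) : GF_GA_K :=
  exist _ (double_coset g) (ex_intro _ g erefl).

Definition borelGA := g_sigma_algebraType (@open GA).

Definition haar_measure (R : realType) (mu : {measure set borelGA -> \bar R}) :=
  [/\ forall (g : GA) (B : set borelGA), measurable B ->
        mu (pgl_mul g @` B) = mu B,
      forall C : set GA, compact C -> (mu C < +oo)%E
    & forall U : set GA, open U -> U !=set0 -> (0 < mu U)%E].

End AdelicGroup.

Definition cintegral d (T : measurableType d) (R : realType)
    (mu : {measure set T -> \bar R}) (f : T -> R[i]) : R[i] :=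
  Complex (\int[mu]_(t in setT) complex.Re (f t))
          (\int[mu]_(t in setT) complex.Im (f t)).

Section ProjectiveLine.
Variable k : finFieldType.

Definition vec2 (a b : k) : 'rV[k]_2 := \row_j if j == 0 then a else b.

(* [pt a b] is the point [a : b], i.e. the line spanned by (a, b). *)
Definition pt (a b : k) : {set 'rV[k]_2} := [set c *: vec2 a b | c : k]%SET.

Definition P1 : {set {set 'rV[k]_2}} :=
  [set pt ab.1 ab.2 | ab : k * k & ab != (0, 0)]%SET.

End ProjectiveLine.

Section HeckeOperator.
Variables (F : fieldType) (Fc : forall y : place F, completion y).
Variables (x : place F) (kx : residue_field (cval (Fc x))).
Variables (pix : Fc x) (pix1 : cval (Fc x) pix = 1%:E).
Variables (R : realType) (mu : {measure set (borelGA Fc) -> \bar R}).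

Local Notation A := (adele Fc).

Definition pi_idele : A := adele_with 1 pix.
Definition pi_ideleV : A := adele_with 1 pix^-1.

Fact pi_ideleP : pi_idele * pi_ideleV = 1.
Proof.
apply: adele_ext => y /=.
have [<-|xy] := eqVneq x y; last by rewrite !dfwithout // mulr1.
rewrite !dfwithin mulfV //; apply/eqP => pix0.
by move: pix1; rewrite pix0 dval0.
Qed.

Definition residue_adele (b : kx) : A := adele_with 0 (ival (rf_lift kx b)).

Definition upper_xi (b : A) : GA Fc :=
  pgl_class (upper_gl2 b pi_ideleP (mulr1 1)).

Definition lower_xi : GA Fc := pgl_class (upper_gl2 0 (mulr1 1) pi_ideleP).

Definition xi (w : {set 'rV[kx]_2}) : GA Fc :=
  if [pick b : kx | w == pt 1 b] is Some b then upper_xi (residue_adele b)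
  else lower_xi.

Definition K_pi_K : set (GA Fc) := [set h | exists u u',
  [/\ GO u, GO u' & h = pgl_mul (pgl_mul u (upper_xi 0)) u']].

Definition Phi (h : GA Fc) : R[i] := (h \in K_pi_K)%:R.

Definition hecke (f : GF_GA_K Fc -> R[i]) (g : GA Fc) : R[i] :=
  cintegral mu (fun h : borelGA Fc => Phi h * f (dcls (pgl_mul g h))).

(* [E] lists the edges ([g], c, m) originating in [g] as pairs (c, m). *)
Definition hecke_edges (g : GA Fc) (E : seq (GF_GA_K Fc * R[i])) :=
  [/\ uniq [seq e.1 | e <- E],
      {in E, forall e, e.2 != 0}
    & forall f, hecke f g = \sum_(e <- E) e.2 * f e.1].

End HeckeOperator.

(* Main.v *)
(** The double coset [K diag(pi_x, 1) K] is the disjoint union of the left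
    cosets [xi_w K] with [w] in P^1(kappa_x): for [u] in K, the coset of
    [u diag(pi_x, 1)] is determined by the residue at [x] of the second column
    of [u].  Each [g K] is open, hence Borel, and has volume 1 by invariance, so
    [Phi_x(f)(g)] is the sum of the [f([g xi_w])].  Testing this identity on
    indicator functions of single classes yields the multiplicities. *)

Require Import Defs.
From mathcomp Require Import all_boot all_order all_algebra all_field.
From mathcomp Require Import fraction generic_quotient.
From mathcomp Require Import all_classical all_reals all_analysis.
From mathcomp Require Import complex ring.

Set Implicit Arguments.
Unset Strict Implicit.
Unset Printing Implicit Defensive.

Import Order.TTheory GRing.Theory Num.Theory.

Local Open Scope classical_set_scope.
Local Open Scope ring_scope.

(** * The group PGL_2 over a commutative ring, and explicit 2 by 2 matrices *)

Section GL2Theory.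
Variable A : comPzRingType.
Implicit Types (M N : GL2 A) (g h : PGL2 A).

Definition gl_invg M : GL2 A := MkGL2 (gl_Vmx M) (gl_mxV M).

Lemma pgl_classP M N : pgl_class M = pgl_class N <->
  exists c d : A, c * d = 1 /\ gl_mx N = c *: gl_mx M.
Proof.
rewrite /pgl_class; split; first by move/eqmodP/asboolP.
by move=> e; apply/eqmodP/asboolP.
Qed.

(** Equality of classes ignores the stored inverses, so identities in PGL_2 reduce to matrix
    identities. *)
Lemma eq_pgl_class M N : gl_mx M = gl_mx N -> pgl_class M = pgl_class N.
Proof. by move=> e; apply/pgl_classP; exists 1, 1; rewrite mulr1 scale1r. Qed.

Lemma pgl_classK g : pgl_class (repr g) = g.
Proof. exact: reprK. Qed.

Lemma pgl_mulA : associative (@pgl_mul A).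
Proof.
move=> g h k; rewrite -[g]pgl_classK -[h]pgl_classK -[k]pgl_classK !pgl_mulE.
by apply: eq_pgl_class; rewrite /= mulmxA.
Qed.

Lemma pgl_mul1 g : pgl_mul g (pgl_class (gl_one A)) = g.
Proof.
rewrite -{2}[g]pgl_classK -{1}[g]pgl_classK pgl_mulE.
by apply: eq_pgl_class; rewrite /= mulmx1.
Qed.

Lemma pgl_1mul g : pgl_mul (pgl_class (gl_one A)) g = g.
Proof.
rewrite -{2}[g]pgl_classK -{1}[g]pgl_classK pgl_mulE.
by apply: eq_pgl_class; rewrite /= mul1mx.
Qed.

Lemma pgl_mulV M :
  pgl_mul (pgl_class M) (pgl_class (gl_invg M)) = pgl_class (gl_one A).
Proof. by rewrite pgl_mulE; apply: eq_pgl_class; rewrite /= gl_mxV. Qed.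

Lemma gl_inv_scale M N (c d : A) : c * d = 1 -> gl_mx N = c *: gl_mx M ->
  gl_inv N = d *: gl_inv M.
Proof.
move=> cd e; have : gl_inv N *m gl_mx N *m (d *: gl_inv M) = d *: gl_inv M.
  by rewrite gl_Vmx mul1mx.
by rewrite {1}e -mulmxA -scalemxAl -!scalemxAr scalerA cd scale1r gl_mxV mulmx1.
Qed.

Lemma mx2E (M : 'M[A]_2) : M = mx2 (M 0 0) (M 0 1) (M 1 0) (M 1 1).
Proof.
by apply/matrixP => i j; rewrite mxE; case: i j => [[|[|//]] ?] [[|[|//]] ?] //=;
  congr (M _ _); apply: val_inj.
Qed.

Lemma mx2_mul (a b c d a' b' c' d' : A) :
  mx2 a b c d *m mx2 a' b' c' d' =
  mx2 (a * a' + b * c') (a * b' + b * d') (c * a' + d * c') (c * b' + d * d').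
Proof.
apply/matrixP => i j; rewrite !mxE big_ord_recl big_ord1 !mxE /=.
by case: i j => [[|[|//]] ?] [[|[|//]] ?].
Qed.

Lemma mx2_scale (e a b c d : A) :
  e *: mx2 a b c d = mx2 (e * a) (e * b) (e * c) (e * d).
Proof.
by apply/matrixP => i j; rewrite !mxE; case: ifP; case: ifP.
Qed.

Lemma mx2_1 : 1%:M = mx2 1 0 0 1 :> 'M[A]_2.
Proof.
by apply/matrixP => i j; rewrite !mxE; case: i j => [[|[|//]] ?] [[|[|//]] ?].
Qed.

Lemma mx2_inj (a b c d a' b' c' d' : A) : mx2 a b c d = mx2 a' b' c' d' ->
  [/\ a = a', b = b', c = c' & d = d'].
Proof.
move=> /matrixP e; have := (e 0 0, e 0 1, e 1 0, e 1 1).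
by rewrite !mxE /= => -[[[]]].
Qed.

Lemma mx2_all (P : A -> Prop) (a b c d : A) :
  (forall i j, P (mx2 a b c d i j)) <-> [/\ P a, P b, P c & P d].
Proof.
split=> [h|[Pa Pb Pc Pd] i j]; last by rewrite mxE; case: ifP; case: ifP.
by move: (h 0 0) (h 0 1) (h 1 0) (h 1 1); rewrite !mxE.
Qed.

End GL2Theory.

(** * Divisibility by a uniformizer and reduction to the residue field *)

Section LocalField.
Variables (K : fieldType) (v : discrete_valuation K).
Variables (p : K) (vp : v p = 1%:E).

Lemma uniformizer_neq0 : p != 0.
Proof. by apply/eqP => p0; move: vp; rewrite p0 dval0. Qed.

Lemma dval_uniformizerV : v p^-1 = (-1)%:E.
Proof.
have [n vn] : exists n : int, v p^-1 = n%:E.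
  by apply: dval_fin; rewrite invr_eq0 uniformizer_neq0.
have := dvalM v p p^-1; rewrite mulfV ?uniformizer_neq0 // dval1 vp vn -EFinD.
by case=> /eqP; rewrite eq_sym addrC addr_eq0 => /eqP ->.
Qed.

(** Finite valuations are integers, so [0 < v s] amounts to [1 <= v s]. Divisibility by [p] thus
    becomes an integrality statement, the form in which matrix entries present it below. *)
Lemma integral_mulVr s : (p^-1 * s \in integral_pred v) = (0 < v s)%E.
Proof.
rewrite unfold_in /integral_pred dvalM dval_uniformizerV.
case: (v s) => [n| |] //.
by rewrite -EFinD lee_fin lte_fin addrC subr_ge0 gtz0_ge1.
Qed.

Lemma uniformizerV_nonintegral : p^-1 \notin integral_pred v.
Proof. by rewrite -[p^-1]mulr1 integral_mulVr dval1. Qed.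

Lemma uniformizer_integral : p \in integral_pred v.
Proof. by rewrite unfold_in /integral_pred vp. Qed.

Variable kx : residue_field v.
Local Notation O := (integers v).

Lemma res_eq0 (s : O) : rf_res kx s = 0 <-> p^-1 * ival s \in integral_pred v.
Proof. by rewrite integral_mulVr; exact: rf_res_ker. Qed.

(* For a matrix with second column [(b, d)] and inverse [(a', b'; c', d')], the
   residue of [(b, d)] spans the line of [(t, 1)], respectively of [(1, 0)]. *)
Lemma unimodular_cases (b c d a' b' c' d' : O) :
  a' * b + b' * d = 0 -> c * a' + d * c' = 0 -> c * b' + d * d' = 1 ->
  (exists t : kx,
     p^-1 * ival (b - rf_lift kx t * d) \in integral_pred v /\
     p^-1 * ival (a' * rf_lift kx t + b') \in integral_pred v) \/
  (p^-1 * ival d \in integral_pred v /\ p^-1 * ival a' \in integral_pred v).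
Proof.
move=> /(congr1 (rf_res kx)); rewrite rmorphD !rmorphM rmorph0 => e1.
move=> /(congr1 (rf_res kx)); rewrite rmorphD !rmorphM rmorph0 => e2.
move=> /(congr1 (rf_res kx)); rewrite rmorphD !rmorphM rmorph1 => e3.
have [d0|d0] := eqVneq (rf_res kx d) 0.
  right; split; first exact/res_eq0.
  (* As the residue of [d] vanishes, [e3] reads [c * b' = 1], so [c] has nonzero residue, and [e2]
     then forces that of [a'] to vanish. *)
  apply/res_eq0; move: e2 e3; rewrite d0 !mul0r !addr0 => /eqP.
  rewrite mulf_eq0 => /orP[/eqP ->|/eqP //].
  by rewrite mul0r => /esym/eqP; rewrite oner_eq0.
have [t tE] : exists t, t * rf_res kx d = rf_res kx b.
  by exists (rf_res kx b / rf_res kx d); rewrite divfK.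
left; exists t; split; apply/res_eq0.
  by rewrite rmorphB rmorphM rf_liftK tE subrr.
(* Multiplied by the nonzero residue of [d], the claim becomes [a' * b + b' * d = 0], which is
   [e1]. *)
by rewrite rmorphD rmorphM rf_liftK; apply: (mulIf d0); rewrite mul0r mulrDl -mulrA tE.
Qed.

Lemma lift_res_inj (t t' : kx) :
  p^-1 * (ival (rf_lift kx t) - ival (rf_lift kx t')) \in integral_pred v ->
  t = t'.
Proof.
move=> h; have : rf_res kx (rf_lift kx t - rf_lift kx t') = 0 by apply/res_eq0.
by rewrite rmorphB !rf_liftK => /eqP; rewrite subr_eq0 => /eqP.
Qed.

End LocalField.

(** * Openness and algebra of the cosets g K *)

Section AdelicTopology.
Variables (F : fieldType) (Fc : forall y : place F, completion y).
Local Notation A := (adele Fc).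
Local Notation O y := (integral_pred (cval (Fc y))).

Lemma integral_adeleD (a b : A) :
  integral_adele a -> integral_adele b -> integral_adele (a + b).
Proof. by move=> ia ib y; apply: rpredD; [exact: ia|exact: ib]. Qed.

Lemma integral_adele0 : integral_adele (0 : A).
Proof. by move=> y; exact: rpred0. Qed.

Lemma integral_adele1 : integral_adele (1 : A).
Proof. by move=> y; exact: rpred1. Qed.

Lemma integral_adeleM (a b : A) :
  integral_adele a -> integral_adele b -> integral_adele (a * b).
Proof. by move=> ia ib y; apply: rpredM; [exact: ia|exact: ib]. Qed.

Lemma integral_adele_sum (I : finType) (f : I -> A) :
  (forall i, integral_adele (f i)) -> integral_adele (\sum_i f i).
Proof.
move=> h; elim/big_ind: _ => [|a b|i _]; last exact: h.
- exact: integral_adele0.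
- exact: integral_adeleD.
Qed.

(** Continuity at [a] of multiplication by the fixed adele [n]. The condition in [V y] that
    [t - a y] be integral makes [V y] the full ring of integers wherever [n] and [a] are integral,
    hence at almost all places, as the restricted product topology demands. *)
Lemma integral_mul_near (n a : A) :
  nbhs a [set t : A | integral_adele (n * (t - a))].
Proof.
pose V y := [set t : Fc y | t - a y \in O y /\ n y * (t - a y) \in O y].
pose W := [set t : A | forall y, V y (t y)].
have oV y : val_open (cval (Fc y)) (V y).
  move=> t [t1 t2].
  (* The bound is minus the valuation of [n y]; if [n y = 0] any integer serves, and 0 is taken. *)
  have [m mP] : exists m : int, forall s, (m%:E <= cval (Fc y) s)%E ->
      n y * s \in O y.
    have [n0|n0] := eqVneq (n y) 0; first by exists 0 => s _; rewrite n0 mul0r rpred0.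
    have [m vm] := dval_fin (cval (Fc y)) n0; exists (- m) => s sm.
    rewrite unfold_in /integral_pred dvalM vm.
    case: (cval (Fc y) s) sm => [r| |] //=.
    by rewrite -EFinD !lee_fin -lerBlDl sub0r.
  exists (Order.max 0 m) => s hs.
  have [s0 sm] : (0%:E <= cval (Fc y) (s - t)%R)%E /\ (m%:E <= cval (Fc y) (s - t)%R)%E.
    by split; apply: le_trans hs; rewrite lee_fin le_max lexx ?orbT.
  have -> : V y s = (s - t + (t - a y) \in O y /\ n y * (s - t + (t - a y)) \in O y).
    by rewrite addrA subrK.
  split; first exact: rpredD.
  by rewrite mulrDr; apply: rpredD => //; exact: mP.
have oW : open W.
  move=> b Wb; exists V; split=> //.
  have : finite_set ([set y | n y \notin O y] `|` [set y | a y \notin O y]).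
    by rewrite finite_setU; split; exact: acompP.
  apply: sub_finite_set => y /= hV; apply: contrapT => /not_orP[].
  move=> /negP; rewrite negbK => ny /negP; rewrite negbK => ay; apply: hV.
  apply/seteqP; split=> t /=; first by case=> h _; rewrite -[t](subrK (a y)) rpredD.
  by move=> ht; have h : t - a y \in O y by [exact: rpredB]; split=> //; exact: rpredM.
have Wa : W a by move=> y; rewrite /V /= subrr mulr0; split; exact: rpred0.
apply: (@filterS _ (nbhs a) _ W); last exact: open_nbhs_nbhs.
by move=> t Wt y; have [] := Wt y.
Qed.

(** Write [N *m Q] as [N *m (Q - P) + N *m P]: the entries of the first summand are finite sums of
    terms that are integral for [Q] near [P]. A neighbourhood of [P] is given by a matrix of
    neighbourhoods of its entries; the one at [(k, j)] serves all rows [i] at once. *)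
Lemma open_integral_mulmx (N : 'M[A]_2) :
  open [set P : 'M[A]_2 | forall i j, integral_adele ((N *m P) i j)].
Proof.
rewrite openE => P hP; rewrite /interior.
exists (fun k j => [set t : A | forall i, integral_adele (N i k * (t - P k j))]).
  move=> k j; apply: (@filter_forall A 'I_2
    (fun i t => integral_adele (N i k * (t - P k j))) _
    (nbhs_filter _)) => i.
  exact: integral_mul_near.
move=> Q hQ i j; rewrite -[Q](subrK P) mulmxDr mxE.
apply: integral_adeleD; last exact: hP.
rewrite mxE; apply: integral_adele_sum => k.
by have := hQ k j i; rewrite !mxE.
Qed.

Lemma open_integral_mulmxr (N : 'M[A]_2) :
  open [set P : 'M[A]_2 | forall i j, integral_adele ((P *m N) i j)].
Proof.
rewrite openE => P hP; rewrite /interior.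
exists (fun i k => [set t : A | forall j, integral_adele (N k j * (t - P i k))]).
  move=> i k; apply: (@filter_forall A 'I_2
    (fun j t => integral_adele (N k j * (t - P i k))) _
    (nbhs_filter _)) => j.
  exact: integral_mul_near.
move=> Q hQ i j; rewrite -[Q](subrK P) mulmxDl mxE.
apply: integral_adeleD; last exact: hP.
rewrite mxE; apply: integral_adele_sum => k.
by have := hQ i k j; rewrite !mxE mulrC.
Qed.

Definition lcosetK (g : GA Fc) : set (GA Fc) := pgl_mul g @` @GO F Fc.

(** Classes are taken modulo invertible scalars, so [N] lies in the coset of [M] when some scalar
    multiple of M^-1 N is in GL_2(O_A). The two matrices displayed are inverse to each other, and
    membership means that both are integral. *)
Lemma lcosetK_classP (M N : GL2 A) : lcosetK (pgl_class M) (pgl_class N) <->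
  exists c d : A, [/\ c * d = 1,
    forall i j, integral_adele ((c *: gl_inv M *m gl_mx N) i j)
  & forall i j, integral_adele ((gl_inv N *m (d *: gl_mx M)) i j)].
Proof.
split=> [[_ [U [iU [iU' ->]]]]|[c [d [cd ic id]]]].
  rewrite pgl_mulE => /pgl_classP[e [f [ef eN]]].
  have eN' := gl_inv_scale ef eN.
  exists f, e; rewrite mulrC ef; split=> // i j.
    rewrite eN /= -scalemxAl -!scalemxAr scalerA mulrC ef scale1r mulmxA.
    by rewrite gl_Vmx mul1mx; exact: iU.
  rewrite eN' /= -scalemxAr -!scalemxAl scalerA ef scale1r -mulmxA.
  by rewrite gl_Vmx mulmx1; exact: iU'.
pose P := c *: gl_inv M *m gl_mx N; pose Q := gl_inv N *m (d *: gl_mx M).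
have PQ : P *m Q = 1%:M.
  rewrite /P /Q mulmxA -(mulmxA _ (gl_mx N)) gl_mxV mulmx1 -scalemxAl -scalemxAr.
  by rewrite scalerA cd scale1r gl_Vmx.
have QP : Q *m P = 1%:M.
  rewrite /P /Q mulmxA -(mulmxA (gl_inv N)) -scalemxAl -!scalemxAr.
  by rewrite scalerA mulrC cd scale1r gl_mxV mulmx1 gl_Vmx.
exists (pgl_class (MkGL2 PQ QP)); first by exists (MkGL2 PQ QP).
rewrite pgl_mulE; apply/pgl_classP; exists d, c; rewrite mulrC cd; split=> //=.
by rewrite /P -scalemxAl -scalemxAr scalerA mulrC cd scale1r mulmxA gl_mxV mul1mx.
Qed.

(** Openness is tested on the preimage in GL_2(A). This is a union over the scalar pairs [(c, d)] of
    sets cut out by one open condition on the matrix and one on its inverse, both of which depend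
    continuously on the element for the topology induced by [gl_pair]. *)
Lemma open_lcosetK (g : GA Fc) : open (lcosetK g).
Proof.
rewrite -[g]pgl_classK; set M := repr g.
pose I := {cd : A * A | cd.1 * cd.2 = 1}.
pose f (s : I) := (fun N : initial_topology (@gl_pair F Fc) => (gl_pair N).1) @^-1`
    [set P | forall i j, integral_adele (((sval s).1 *: gl_inv M *m P) i j)] `&`
  (fun N : initial_topology (@gl_pair F Fc) => (gl_pair N).2) @^-1`
    [set P | forall i j, integral_adele ((P *m ((sval s).2 *: gl_mx M)) i j)].
suff E : @pgl_class A @^-1` lcosetK (pgl_class M) = \bigcup_s f s.
  rewrite /open /=.
  change (adelic_gl2_open (@pgl_class A @^-1` lcosetK (pgl_class M))).
  rewrite E; apply: bigcup_open => s _; apply: openI.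
    apply: open_comp; last exact: open_integral_mulmx.
    move=> N _; apply: continuous_comp; first exact: initial_continuous.
    exact: cvg_fst.
  apply: open_comp; last exact: open_integral_mulmxr.
  move=> N _; apply: continuous_comp; first exact: initial_continuous.
  exact: cvg_snd.
apply/seteqP; split=> N /=.
  by move/lcosetK_classP => [c [d [cd h1 h2]]]; exists (exist _ (c, d) cd).
by move=> [[[c d] /= cd] _ [h1 h2]]; apply/lcosetK_classP; exists c, d.
Qed.

Lemma GO1 : GO (pgl_class (gl_one A)).
Proof.
exists (gl_one A); rewrite /= mx2_1; split; first last; first split=> //.
all: by apply/(mx2_all (@integral_adele F Fc)); split;
  [exact: integral_adele1|exact: integral_adele0|exact: integral_adele0
  |exact: integral_adele1].
Qed.

Lemma GOM (u u' : GA Fc) : GO u -> GO u' -> GO (pgl_mul u u').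
Proof.
move=> [U [iU [jU ->]]] [U' [iU' [jU' ->]]]; exists (gl_mul U U'); rewrite pgl_mulE.
split; last split=> //; move=> i j; rewrite mxE; apply: integral_adele_sum => k;
  exact: integral_adeleM.
Qed.

Lemma GOV (u : GA Fc) : GO u ->
  exists2 u', GO u' & pgl_mul u u' = pgl_class (gl_one A).
Proof.
move=> [U [iU [jU ->]]]; exists (pgl_class (gl_invg U)); last exact: pgl_mulV.
by exists (gl_invg U).
Qed.

Lemma lcosetK_sym (g h : GA Fc) : lcosetK g h -> lcosetK h g.
Proof.
move=> [u Ku <-]; have [u' Ku' uu'] := GOV Ku; exists u' => //.
by rewrite -pgl_mulA uu' pgl_mul1.
Qed.

Lemma lcosetK_trans (g h k : GA Fc) : lcosetK g h -> lcosetK h k -> lcosetK g k.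
Proof.
move=> [u Ku <-] [u' Ku' <-]; exists (pgl_mul u u'); first exact: GOM.
by rewrite pgl_mulA.
Qed.

Lemma lcosetK_mull (g h k : GA Fc) :
  lcosetK h k -> lcosetK (pgl_mul g h) (pgl_mul g k).
Proof. by move=> [u Ku <-]; exists u => //; rewrite pgl_mulA. Qed.

Lemma lcosetK_mulr (g h u : GA Fc) : GO u -> lcosetK g h -> lcosetK g (pgl_mul h u).
Proof. by move=> Ku gh; apply: lcosetK_trans gh _; exists u. Qed.

Lemma dcls_lcosetK (g h : GA Fc) : lcosetK g h -> dcls h = dcls g.
Proof.
have sub (g1 g2 : GA Fc) : lcosetK g1 g2 -> double_coset g2 `<=` double_coset g1.
  move=> [u Ku <-] _ [gamma [u' [Fg Ku' ->]]]; exists gamma, (pgl_mul u u').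
  by split; rewrite ?pgl_mulA //; exact: GOM.
move=> gh; apply: eq_exist; apply/seteqP; split; apply: sub => //.
exact: lcosetK_sym.
Qed.

End AdelicTopology.

(** * Normal forms of the points of the projective line *)

Section ProjectiveLineTheory.
Variable k : finFieldType.

Lemma ptP (a b a' b' : k) : pt a b = pt a' b' ->
  exists c, a = c * a' /\ b = c * b'.
Proof.
move=> e; have : vec2 a b \in pt a b.
  by apply/imsetP; exists 1; rewrite ?scale1r.
rewrite e => /imsetP[c _ /rowP h]; exists c.
by move: (h 0) (h 1); rewrite !mxE /=.
Qed.

Lemma pt_scale (c a b : k) : c != 0 -> pt (c * a) (c * b) = pt a b.
Proof.
move=> c0; have E : vec2 (c * a) (c * b) = c *: vec2 a b.
  by apply/rowP => j; rewrite !mxE; case: ifP.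
apply/setP => r; apply/imsetP/imsetP => -[d _ ->].
  by exists (d * c); rewrite // E scalerA.
by exists (d / c); rewrite // E scalerA divfK.
Qed.

Lemma pt1_inj : injective (pt (1 : k)).
Proof.
by move=> b b' /ptP[c []]; rewrite mulr1 => <-; rewrite mul1r.
Qed.

Lemma pt01_neq (b : k) : pt 0 1 != pt 1 b.
Proof.
apply/eqP => /ptP[c []]; rewrite mulr1 => <- /eqP.
by rewrite mul0r oner_eq0.
Qed.

(** A vector with nonzero first coordinate is rescaled to [(1, b)], any other nonzero vector to
    [(0, 1)]. *)
Lemma P1E : P1 k = (pt 0 1 |: [set pt (1 : k) b | b : k])%SET.
Proof.
apply/setP => w; rewrite in_setU1; apply/imsetP/orP.
  move=> [[a b]]; rewrite inE => ab0 ->.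
  have [a0|a0] := eqVneq a 0.
    left; move: ab0; rewrite a0 xpair_eqE eqxx /= => b0.
    by rewrite -(pt_scale 0 1 b0) mulr0 mulr1.
  right; apply/imsetP; exists (b / a) => //.
  by rewrite -(pt_scale 1 (b / a) a0) mulr1 mulrC divfK.
case=> [/eqP ->|/imsetP[b _ ->]].
  by exists (0, 1) => //; rewrite inE xpair_eqE oner_eq0 andbF.
by exists (1, b) => //; rewrite inE xpair_eqE oner_eq0.
Qed.

Lemma P1_cases (w : {set 'rV[k]_2}) : w \in P1 k ->
  w = pt 0 1 \/ exists b, w = pt 1 b.
Proof.
rewrite P1E in_setU1 => /orP[/eqP ->|/imsetP[b _ ->]]; first by left.
by right; exists b.
Qed.

Lemma card_P1 : #|P1 k| = #|k|.+1.
Proof.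
rewrite P1E cardsU1 card_imset; last exact: pt1_inj.
by case: imsetP => [[b _ /eqP]|_ //]; rewrite (negPf (pt01_neq b)).
Qed.

End ProjectiveLineTheory.

(** * Decomposition of K diag(pi_x, 1) K into the cosets xi_w K *)

Section HeckeDecomposition.
Variables (F : fieldType) (Fc : forall y : place F, completion y).
Variables (x : place F) (kx : residue_field (cval (Fc x))).
Variables (pix : Fc x) (pix1 : cval (Fc x) pix = 1%:E).
Local Notation A := (adele Fc).
Local Notation O y := (integral_pred (cval (Fc y))).

Lemma acompD (a b : A) y : (a + b) y = a y + b y. Proof. by []. Qed.
Lemma acompM (a b : A) y : (a * b) y = a y * b y. Proof. by []. Qed.
Lemma acompN (a : A) y : (- a) y = - a y. Proof. by []. Qed.
Lemma acomp0 y : (0 : A) y = 0. Proof. by []. Qed.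
Lemma acomp1 y : (1 : A) y = 1. Proof. by []. Qed.
Definition acompE := (acompD, acompM, acompN, acomp0, acomp1).

Lemma adele_with_same (a : A) (c : Fc x) : adele_with a c x = c.
Proof. exact: dfwithin. Qed.

Lemma adele_with_other (a : A) (c : Fc x) y : x != y -> adele_with a c y = a y.
Proof. by move=> xy; exact: dfwithout. Qed.

Lemma integral_adele_split (a : A) :
  a x \in O x -> (forall y, x != y -> a y \in O y) -> integral_adele a.
Proof. by move=> ax ay y; have [<-|/ay] := eqVneq x y. Qed.

Let pi0 : pix != 0 := uniformizer_neq0 pix1.

Lemma lift_integral (t : kx) : ival (rf_lift kx t) \in O x.
Proof. exact: ivalP. Qed.

(** [xi] picks some [b'] with [pt 1 b = pt 1 b']; injectivity of [pt 1] identifies it with [b]. *)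
Lemma xi_pt1 (b : kx) : xi pix1 (pt 1 b) = upper_xi pix1 (residue_adele b).
Proof.
rewrite /xi; case: pickP => [b' /eqP/pt1_inj -> //|/(_ b)].
by rewrite eqxx.
Qed.

Lemma xi_pt01 : xi pix1 (pt 0 1 : {set 'rV[kx]_2}) = lower_xi pix1.
Proof. by rewrite /xi; case: pickP => [b|//]; rewrite (negPf (pt01_neq b)). Qed.

(** Removes the unknown scalar of [lcosetK_classP]: [s] is [d x] times [c x * s]. *)
Lemma scaled_integral_unit (c d : A) (s : Fc x) : c * d = 1 ->
  d x \in O x -> c x * s \in O x -> s \in O x.
Proof.
move=> cd dx cs; rewrite -[s]mul1r -(acomp1 x) -cd acompM [c x * _]mulrC -mulrA.
exact: rpredM.
Qed.

(** Splits off the equality as a separate goal for [ring] or [field]. *)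
Lemma eq_integral_pred y (a b : Fc y) : a = b -> b \in O y -> a \in O y.
Proof. by move=> ->. Qed.

Lemma lcosetK_upper (t t' : kx) :
  lcosetK (upper_xi pix1 (residue_adele t)) (upper_xi pix1 (residue_adele t')) ->
  t = t'.
Proof.
move=> /lcosetK_classP[c [d [cd]]]; rewrite /= !mx2_scale !mx2_mul.
(* The entries kept, at [x], are c pi^-1 (t' - t) from the first matrix and d from the second. *)
move=> /mx2_all[_ /(_ x) h _ _] /mx2_all[_ _ _ /(_ x) hd].
apply/esym/(lift_res_inj pix1); apply: (scaled_integral_unit cd).
  by move: hd; rewrite !acompE mul1r mul0r add0r mulr1.
move: h; rewrite !acompE /pi_ideleV /residue_adele !adele_with_same.
by apply: eq_integral_pred; ring.
Qed.

Lemma lcosetK_upper_lower (t : kx) :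
  ~ lcosetK (upper_xi pix1 (residue_adele t)) (lower_xi pix1).
Proof.
move=> /lcosetK_classP[c [d [cd]]]; rewrite /= !mx2_scale !mx2_mul.
move=> /mx2_all[/(_ x) h _ _ _] /mx2_all[_ _ _ /(_ x) h'].
(* The entries kept are c pi^-1 and d pi^-1. Their product is pi^-2, and a further factor pi would
   make pi^-1 integral. *)
have cdx : c x * d x = 1 by rewrite -acompM cd.
move: (rpredM h h'); rewrite !acompE /pi_ideleV /pi_idele !adele_with_same.
move=> H; have : pix^-1 * pix^-1 \in O x.
  by rewrite -[X in X \in _]mul1r -cdx; apply: eq_integral_pred H; ring.
move=> /(rpredM (uniformizer_integral pix1)); rewrite mulVKf //.
by apply/negP; exact: uniformizerV_nonintegral.
Qed.

Lemma lcosetK_xi_inj (w w' : {set 'rV[kx]_2}) : w \in P1 kx -> w' \in P1 kx ->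
  lcosetK (xi pix1 w) (xi pix1 w') -> w = w'.
Proof.
move=> /P1_cases[->|[t ->]] /P1_cases[->|[t' ->]]; rewrite ?xi_pt01 ?xi_pt1 //.
- by move/lcosetK_sym/lcosetK_upper_lower.
- by move/lcosetK_upper_lower.
- by move/lcosetK_upper ->.
Qed.

(** At a place other than [x] the uniformizer idele is 1 and the residue adele is 0, so each matrix
    entry collapses to a single entry of [U] or of its inverse, which is integral by hypothesis. *)
Ltac away_from_x := move=> y xy; rewrite ?acompE ?adele_with_other // ?acompE
  ?(mulr0, mul0r, mul1r, mulr1, addr0, add0r, oppr0);
  match goal with H : integral_adele _ |- _ => exact: H end.

(** If [(b, d)] is the second column of a matrix of [u], then [w] is the point [d : b] of residues
    at [x]. The scalars in [lcosetK_classP] can be taken to be 1; at [x], one entry in each of the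
    two matrices carries a factor pi^-1 that only [unimodular_cases] can absorb. *)
Lemma GO_mul_xi (u : GA Fc) : GO u ->
  exists2 w, w \in P1 kx & lcosetK (xi pix1 w) (pgl_mul u (upper_xi pix1 0)).
Proof.
move=> [U [iU [jU ->]]]; rewrite pgl_mulE.
have := (gl_mxV U, gl_Vmx U, mx2E (gl_mx U), mx2E (gl_inv U)).
move: (iU 0 0) (iU 0 1) (iU 1 0) (iU 1 1) (jU 0 0) (jU 0 1) (jU 1 0) (jU 1 1).
move: (gl_mx U 0 0) (gl_mx U 0 1) (gl_mx U 1 0) (gl_mx U 1 1) => a b c d.
move: (gl_inv U 0 0) (gl_inv U 0 1) (gl_inv U 1 0) (gl_inv U 1 1) => a' b' c' d'.
move=> ia ib ic id ia' ib' ic' id' [[[UV VU] EU] EV].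
move: UV VU; rewrite EU EV !mx2_mul mx2_1 => /mx2_inj[_ _ e1 e2] /mx2_inj[_ e3 _ _].
have ipi := uniformizer_integral pix1.
have [ax cx] := (ia x, ic x); have [c'x d'x] := (ic' x, id' x).
case: (@unimodular_cases _ _ _ pix1 kx (Integer (ib x)) (Integer (ic x))
  (Integer (id x)) (Integer (ia' x)) (Integer (ib' x)) (Integer (ic' x))
  (Integer (id' x))).
- by apply: val_inj; exact: (congr1 (fun z : A => z x) e3).
- by apply: val_inj; exact: (congr1 (fun z : A => z x) e1).
- by apply: val_inj; exact: (congr1 (fun z : A => z x) e2).
- move=> [t [/= h1 h2]]; have it := lift_integral t.
  exists (pt 1 t); first by rewrite P1E in_setU1 imset_f ?orbT.
  rewrite xi_pt1; apply/lcosetK_classP; exists 1, 1; rewrite mulr1 !scale1r /=.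
  rewrite EU EV !mx2_mul /pi_ideleV /pi_idele /residue_adele; split=> //;
    apply/(mx2_all (@integral_adele F Fc)); split; apply: integral_adele_split;
    rewrite ?acompE ?adele_with_same; try by away_from_x.
  + apply: (eq_integral_pred (b := a x - ival (rf_lift kx t) * c x)); first by field.
    by apply: rpredB => //; apply: rpredM.
  + by apply: eq_integral_pred h1; ring.
  + by apply: (eq_integral_pred (b := c x * pix)); [ring|exact: rpredM].
  + by apply: eq_integral_pred (id x); ring.
  + by apply: eq_integral_pred (ia' x); field.
  + by apply: eq_integral_pred h2; ring.
  + by apply: (eq_integral_pred (b := c' x * pix)); [ring|exact: rpredM].
  + apply: (eq_integral_pred (b := c' x * ival (rf_lift kx t) + d' x)); first by ring.
    by apply: rpredD => //; apply: rpredM.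
- move=> /= [h1 h2]; exists (pt 0 1); first by rewrite P1E in_setU1 eqxx.
  rewrite xi_pt01; apply/lcosetK_classP; exists 1, 1; rewrite mulr1 !scale1r /=.
  rewrite EU EV !mx2_mul /pi_ideleV /pi_idele; split=> //;
    apply/(mx2_all (@integral_adele F Fc)); split; apply: integral_adele_split;
    rewrite ?acompE ?adele_with_same; try by away_from_x.
  + by apply: (eq_integral_pred (b := a x * pix)); [ring|exact: rpredM].
  + by apply: eq_integral_pred (ib x); ring.
  + by apply: eq_integral_pred (ic x); field.
  + by apply: eq_integral_pred h1; ring.
  + by apply: eq_integral_pred h2; ring.
  + by apply: eq_integral_pred (ib' x); field.
  + by apply: eq_integral_pred (ic' x); ring.
  + by apply: (eq_integral_pred (b := pix * d' x)); [ring|exact: rpredM].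
Qed.

Lemma mem_lcosetK_xi (w : {set 'rV[kx]_2}) : w \in P1 kx ->
  lcosetK (xi pix1 w) `<=` K_pi_K pix1.
Proof.
suff H g u u' : GO u -> GO u' -> g = pgl_mul (pgl_mul u (upper_xi pix1 0)) u' ->
    lcosetK g `<=` K_pi_K pix1.
  move=> /P1_cases[->|[t ->]]; rewrite ?xi_pt01 ?xi_pt1.
    (* The coordinate swap lies in K and conjugates diag(pi, 1) into diag(1, pi), the matrix of
       [lower_xi]. *)
    have ss : mx2 0 1 1 0 *m mx2 0 1 1 0 = 1%:M :> 'M[A]_2.
      by rewrite mx2_mul mx2_1 !(mulr0, mul0r, mul1r, addr0, add0r).
    have Ks : GO (pgl_class (MkGL2 ss ss)).
      exists (MkGL2 ss ss); split; last split=> //; apply/(mx2_all (@integral_adele F Fc));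
        by split; first [exact: integral_adele0|exact: integral_adele1].
    apply: (H _ _ _ Ks Ks); rewrite (pgl_mulE (MkGL2 ss ss)) pgl_mulE.
    apply: eq_pgl_class => /=.
    by rewrite !mx2_mul !(mulr0, mul0r, mul1r, mulr1, addr0, add0r).
  (* The unipotent matrix (1, t; 0, 1) lies in K and takes diag(pi, 1) to (pi, t; 0, 1) by left
     multiplication. *)
  pose u := upper_gl2 (residue_adele t) (mulr1 1) (mulr1 1) : GL2 A.
  have it : integral_adele (residue_adele t : A).
    apply: integral_adele_split => [|y xy].
      by rewrite adele_with_same lift_integral.
    by rewrite adele_with_other // rpred0.
  have Ku : GO (pgl_class u).
    exists u; split; last split=> //; apply/(mx2_all (@integral_adele F Fc)); split=> //;
      try exact: integral_adele0; try exact: integral_adele1.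
    by move=> y; rewrite mulr1 mul1r rpredN; exact: it.
  apply: (H _ _ _ Ku (@GO1 F Fc)); rewrite pgl_mul1 pgl_mulE.
  apply: eq_pgl_class => /=.
  by rewrite !mx2_mul !(mulr0, mul0r, mul1r, mulr1, addr0, add0r).
move=> Ku Ku' -> _ [u2 Ku2 <-]; exists u, (pgl_mul u' u2); split=> //.
  exact: GOM.
by rewrite pgl_mulA.
Qed.

Lemma K_pi_K_cover (h : GA Fc) : K_pi_K pix1 h ->
  exists2 w, w \in P1 kx & lcosetK (xi pix1 w) h.
Proof.
move=> [u [u' [Ku Ku' ->]]]; have [w Pw ww] := GO_mul_xi Ku.
by exists w => //; exact: lcosetK_mulr.
Qed.

End HeckeDecomposition.

(** * Integration over finitely many cosets of volume 1 *)

Lemma Rintegral_sum_indic d (T : measurableType d) (R : realType)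
    (mu : {measure set T -> \bar R}) (I : finType) (P : pred I)
    (D : I -> set T) (r : I -> R) :
    (forall i, measurable (D i)) -> (forall i, mu (D i) = 1%E) ->
  \int[mu]_(t in setT) (\sum_(i | P i) r i * \1_(D i) t) = \sum_(i | P i) r i.
Proof.
(* Finite volume makes each indicator integrable, as linearity of the integral requires. *)
move=> mD muD; have intD i : mu.-integrable setT (fun t => (\1_(D i) t)%:E).
  apply/integrableP; split; first exact/measurable_realfun.measurable_EFinP.
  rewrite (eq_integral (fun t => (\1_(D i) t)%:E)); last first.
    by move=> t _; rewrite gee0_abs // lee_fin.
  by rewrite integral_indic // setIT muD ltry.
rewrite /Rintegral; under eq_integral do rewrite -sumEFin.
rewrite (integral_sum measurableT (f := fun i t => (r i * \1_(D i) t)%:E)).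
  under eq_bigr => i _.
    under eq_integral do rewrite EFinM.
    rewrite integralZl // integral_indic // setIT muD mule1.
    over.
  by rewrite sumEFin.
by move=> i; under eq_fun do rewrite EFinM; exact: integrableZl.
Qed.

Section HeckeEdges.
Variables (F : fieldType) (Fc : forall y : place F, completion y).
Variables (x : place F) (kx : residue_field (cval (Fc x))).
Variables (pix : Fc x) (pix1 : cval (Fc x) pix = 1%:E).
Variables (R : realType) (mu : {measure set (borelGA Fc) -> \bar R}).
Hypotheses (mu_haar : haar_measure mu) (mu_K : mu (@GO F Fc) = 1%:E).

Lemma measurable_lcosetK (g : GA Fc) :
  measurable (lcosetK g : set (borelGA Fc)).
Proof. by apply: sub_sigma_algebra; exact: open_lcosetK. Qed.

(** Exhibits K as a coset, hence as a measurable set to which the invariance of [mu] applies. *)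
Lemma GO_lcosetK : @GO F Fc = lcosetK (pgl_class (gl_one _)).
Proof.
apply/seteqP; split=> [u Ku|_ [u Ku <-]].
  by exists u => //; rewrite pgl_1mul.
by rewrite pgl_1mul.
Qed.

Lemma mu_lcosetK (g : GA Fc) : mu (lcosetK g) = 1%E.
Proof.
rewrite -mu_K; case: mu_haar => inv _ _; apply: inv.
by rewrite GO_lcosetK; exact: measurable_lcosetK.
Qed.

(** The cosets of distinct [w] are disjoint and together fill [K_pi_K], so exactly one summand
    survives when [h] lies there and none otherwise. For [h] in the coset of [xi w], the elements g
    h and g xi_w have the same class. *)
Lemma Phi_sum (f : GF_GA_K Fc -> R[i]) (g h : GA Fc) :
  Phi pix1 R h * f (dcls (pgl_mul g h)) =
  \sum_(w in P1 kx) (h \in lcosetK (xi pix1 w))%:R *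
    f (dcls (pgl_mul g (xi pix1 w))).
Proof.
rewrite /Phi; have [hK|hK] := boolP (h \in K_pi_K pix1).
  have [w Pw wh] := K_pi_K_cover kx (set_mem hK).
  rewrite (bigD1 w) //= big1 ?addr0 => [|w' /andP[Pw' ww']].
    by rewrite (mem_set wh) (dcls_lcosetK (lcosetK_mull g wh)).
  case: (boolP (h \in _)) => [/set_mem w'h|]; last by rewrite mul0r.
  case/eqP: ww'; apply: (lcosetK_xi_inj (pix1 := pix1) Pw' Pw).
  exact: lcosetK_trans w'h (lcosetK_sym wh).
rewrite mul0r big1 // => w Pw; case: (boolP (h \in _)) => [/set_mem wh|].
  by move/negP: hK => []; apply/mem_set/(mem_lcosetK_xi Pw).
by rewrite mul0r.
Qed.

Lemma Re_sum (I : finType) (P : pred I) (f : I -> R[i]) :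
  complex.Re (\sum_(i | P i) f i) = \sum_(i | P i) complex.Re (f i).
Proof. by apply: (big_morph (@complex.Re R)) => // -[a b] [c d]. Qed.

Lemma Im_sum (I : finType) (P : pred I) (f : I -> R[i]) :
  complex.Im (\sum_(i | P i) f i) = \sum_(i | P i) complex.Im (f i).
Proof. by apply: (big_morph (@complex.Im R)) => // -[a b] [c d]. Qed.

Lemma hecke_sum (f : GF_GA_K Fc -> R[i]) (g : GA Fc) :
  hecke pix1 mu f g = \sum_(w in P1 kx) f (dcls (pgl_mul g (xi pix1 w))).
Proof.
(* [cintegral] treats real and imaginary parts separately; each contributes real coefficients [r] of
   coset indicators. *)
have intE (r : {set 'rV[kx]_2} -> R) : \sum_(w in P1 kx) r w =
    \int[mu]_(h in setT)
      (\sum_(w in P1 kx) r w * \1_(lcosetK (xi pix1 w) : set (borelGA Fc)) h).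
  rewrite Rintegral_sum_indic // => w.
    exact: measurable_lcosetK.
  exact: mu_lcosetK.
apply/eqP; rewrite eq_complex /= Re_sum Im_sum !intE; apply/andP.
split; apply/eqP/eq_Rintegral => h _; rewrite Phi_sum ?(Re_sum, Im_sum);
  apply: eq_bigr => w _; rewrite indicE; case: (_ \in _);
  by rewrite ?(mul1r, mulr1, mul0r, mulr0).
Qed.

End HeckeEdges.

(** * Multiplicities as cardinalities of fibres *)

Lemma sum_snd_indic (T : eqType) (S : pzSemiRingType) (E : seq (T * S)) c :
  c \notin [seq e.1 | e <- E] -> \sum_(e <- E) e.2 * (e.1 == c)%:R = 0.
Proof.
move=> cE; rewrite big_seq big1 // => e eE.
case: eqP => [ec|_]; last by rewrite mulr0.
by move: cE; rewrite -ec map_f.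
Qed.

Lemma sum_snd_indic_mem (T : eqType) (S : pzSemiRingType) (E : seq (T * S)) c m :
  uniq [seq e.1 | e <- E] -> (c, m) \in E ->
  \sum_(e <- E) e.2 * (e.1 == c)%:R = m.
Proof.
elim: E => [//|[c0 m0] E IH] /= /andP[c0E uE]; rewrite inE big_cons /=.
move=> /orP[/eqP[-> ->]|cE]; first by rewrite eqxx mulr1 sum_snd_indic ?addr0.
rewrite IH //; case: eqP => [e|_]; last by rewrite mulr0 add0r.
by move: c0E; rewrite e (map_f fst cE).
Qed.

Section FiberCounting.
Variables (T : eqType) (I : finType) (P : {set I}) (C : I -> T).
Variable S : numDomainType.

Definition fiber_card c := #|[set w in P | C w == c]%SET|.

Lemma fiber_cardE c : (fiber_card c)%:R = \sum_(w in P) (C w == c)%:R :> S.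
Proof.
rewrite /fiber_card -sum1_card natr_sum big_mkcond [RHS]big_mkcond /=.
by apply: eq_bigr => w _; rewrite inE; case: (w \in P) (C w == c) => [] [].
Qed.

Lemma sum_fibers_exists : exists E : seq (T * S),
  [/\ uniq [seq e.1 | e <- E], {in E, forall e, e.2 != 0}
    & forall f : T -> S, \sum_(w in P) f (C w) = \sum_(e <- E) e.2 * f e.1].
Proof.
(* Each value of [C] on [P] is listed once, weighted by the size of its fibre. The weight is nonzero
   since the fibre is nonempty and [S] has characteristic 0. *)
pose u := undup [seq C w | w <- enum P].
exists [seq (c, (fiber_card c)%:R) | c <- u]; split.
- by rewrite -map_comp map_id undup_uniq.
- move=> _ /mapP[c cu ->] /=; rewrite pnatr_eq0 -lt0n.
  move: cu; rewrite mem_undup => /mapP[w]; rewrite mem_enum => wP ->.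
  by apply/card_gt0P; exists w; rewrite inE wP eqxx.
- move=> f; rewrite big_map /=.
  under [RHS]eq_bigr do rewrite fiber_cardE mulr_suml.
  rewrite exchange_big; apply: eq_bigr => w wP.
  rewrite (bigD1_seq (C w)) ?undup_uniq //=; last first.
    by rewrite mem_undup map_f // mem_enum.
  rewrite eqxx mul1r big1 ?addr0 // => c; rewrite eq_sym => /negPf ->.
  by rewrite mul0r.
Qed.

(** The indicator function of [c] isolates the coefficient of [c], and the constant function 1 gives
    the total. *)
Lemma sum_fibers_unique (E : seq (T * S)) :
    uniq [seq e.1 | e <- E] -> {in E, forall e, e.2 != 0} ->
    (forall f : T -> S, \sum_(w in P) f (C w) = \sum_(e <- E) e.2 * f e.1) ->
  [/\ forall c, (exists m, (c, m) \in E) <-> exists2 w, w \in P & c = C w,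
      forall c m, (c, m) \in E -> m = (fiber_card c)%:R
    & \sum_(e <- E) e.2 = #|P|%:R].
Proof.
move=> uE nzE sE.
have cardE c : \sum_(e <- E) e.2 * (e.1 == c)%:R = (fiber_card c)%:R.
  by rewrite fiber_cardE -(sE (fun c' => (c' == c)%:R)).
have mE c m : (c, m) \in E -> m = (fiber_card c)%:R.
  by move=> cE; rewrite -cardE (sum_snd_indic_mem uE cE).
split=> // [c|]; last first.
  under eq_bigr do rewrite -[_.2]mulr1.
  by rewrite -(sE (fun=> 1)) sumr_const.
split=> [[m cE]|[w wP ->]].
  have := nzE _ cE; rewrite /= (mE _ _ cE) pnatr_eq0 -lt0n => /card_gt0P[w].
  by rewrite inE => /andP[wP /eqP <-]; exists w.
(* Were [C w] absent from [E], its indicator would have sum 0, although its fibre contains [w]. *)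
have [/mapP[[c' m] cE /= ->]|/sum_snd_indic] := boolP (C w \in [seq e.1 | e <- E]).
  by exists m.
rewrite cardE => /eqP; rewrite pnatr_eq0 => /eqP/card0_eq/(_ w).
by rewrite inE wP eqxx.
Qed.

End FiberCounting.

Theorem proposition2p3
    (k : finFieldType) (F : fieldExtType {fraction {poly k}})
    (Fc : forall y : place F, completion y)
    (x : place F) (kx : residue_field (cval (Fc x)))
    (pix : Fc x) (pix1 : cval (Fc x) pix = 1%:E)
    (R : realType) (mu : {measure set (borelGA Fc) -> \bar R})
    (mu_haar : haar_measure mu) (mu_K : mu (@GO F Fc) = 1%:E)
    (g : GA Fc) :
  (exists E, hecke_edges pix1 mu g E) /\
  forall E, hecke_edges pix1 mu g E ->
    [/\ forall c, (exists m, (c, m) \in E) <->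
                  exists2 w, w \in P1 kx & c = dcls (pgl_mul g (xi pix1 w)),
        forall c m, (c, m) \in E ->
          m = #|[set w in P1 kx | dcls (pgl_mul g (xi pix1 w)) == c]%SET|%:R,
        \sum_(e <- E) e.2 = #|P1 kx|%:R
      & #|P1 kx| = #|kx|.+1].
Proof.
have sumE f : hecke pix1 mu f g =
    \sum_(w in P1 kx) f (dcls (pgl_mul g (xi pix1 w))) by exact: hecke_sum.
split.
  have [E [uE nzE sE]] := sum_fibers_exists (P1 kx)
    (fun w => dcls (pgl_mul g (xi pix1 w))) R[i].
  by exists E; split=> // f; rewrite sumE.
move=> E [uE nzE sE]; have [||f|h1 h2 h3] := @sum_fibers_unique _ _ (P1 kx)
  (fun w => dcls (pgl_mul g (xi pix1 w))) _ E => //.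
  by rewrite -sumE.
by split=> //; exact: card_P1.
Qed.
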